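(* Let $G$ be a simple graph with vertex set $[n]=\{1,\dots,n\}$ and without isolated vertices, let $S=k[x_1,\dots,x_n]$ be the polynomial ring over a field $k$, and let $\{i,j\}$ be an edge of $G$. Denote by $P$ both the edge $\{i,j\}$ and the prime ideal $(x_i,x_j)$ of $S$. Then for all integers $t\ge 2$, $$v_P\bigl(J(G)^{(t+2)}\bigr)=v_P\bigl(J(G)^{(t)}\bigr)+\gamma_{2,P}.$$
   Context: $S=k[x_1,\dots,x_n]$ is standard graded and $S_d$ denotes its degree-$d$ component. The cover ideal of $G$ is $J(G)=\bigcap_{\{u,v\}\in E(G)}(x_u,x_v)$, and its $t$-th symbolic power is $J(G)^{(t)}=\bigcap_{\{u,v\}\in E(G)}(x_u,x_v)^t$. For a nonzero homogeneous ideal $I$ of $S$ and an associated prime $P$ of $I$, the local $v$-number of $I$ at $P$ is $v_P(I)=\min\{d\ge 0 \mid \exists f\in S_d \text{ such that } I:f=P\}$. For an integer $t\ge1$, a vector $\mathbf a=(a_1,\dots,a_n)\in\mathbb N^n$ ($\mathbb N$ includes $0$) is a $t$-cover of $G$ if $a_u+a_v\ge t$ for every edge $\{u,v\}\in E(G)$. For an edge $P=\{i,j\}$, a $t$-cover $\mathbf a$ is $P$-tight if $a_i+a_j=t$. Write $|\mathbf b|=b_1+\dots+b_n$. Then $\gamma_{t,P}=\min\{|\mathbf b| \mid \mathbf b \text{ is a } P\text{-tight } t\text{-cover of } G\}$. *)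

(* Defs.v *)
From mathcomp Require Import all_boot all_algebra.
From mathcomp Require Export mpoly.
From Stdlib Require Import ClassicalEpsilon.

Set Implicit Arguments.
Unset Strict Implicit.
Unset Printing Implicit Defensive.

Import GRing.Theory.
Local Open Scope ring_scope.

(* The minimum of a set of natural numbers; a junk value if the set is empty. *)
Definition nat_min (A : nat -> Prop) : nat :=
  epsilon (inhabits 0%N) (fun d => A d /\ forall d', A d' -> (d <= d')%N).

Lemma nat_minP (A : nat -> Prop) : (exists d, A d) ->
  A (nat_min A) /\ forall d, A d -> (nat_min A <= d)%N.
Proof.
move=> [d Ad]; apply: (epsilon_spec (inhabits 0%N)
  (fun d => A d /\ forall d', A d' -> (d <= d')%N)).
elim/ltn_ind: d Ad => d IH Ad.
case: (excluded_middle_informative (exists2 d', A d' & (d' < d)%N)) => [[d' Ad' lt]|H].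
  exact: (IH d').
exists d; split=> // d' Ad'; rewrite leqNgt; apply/negP => lt.
by apply: H; exists d'.
Qed.

(* Ideals of a commutative ring are represented by their membership
   predicates, and are compared extensionally. *)
Section Ideals.
Variable R : comNzRingType.
Implicit Types (A I J : R -> Prop) (f g : R).

Definition ideal_eq I J : Prop := forall f, I f <-> J f.

Definition ideal_gen A : R -> Prop := fun f =>
  exists (m : nat) (c g : 'I_m -> R),
    (forall l, A (g l)) /\ f = \sum_(l < m) c l * g l.

Definition ideal_mul I J : R -> Prop :=
  ideal_gen (fun f => exists a b, [/\ I a, J b & f = a * b]).

Definition ideal_exp I (t : nat) : R -> Prop :=
  iter t (ideal_mul I) (fun _ => True).

Definition ideal_colon I f : R -> Prop := fun g => I (g * f).

Lemma ideal_gen_inc A f : A f -> ideal_gen A f.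
Proof.
move=> Af; exists 1%N, (fun=> 1), (fun=> f); split=> //.
by rewrite big_ord1 mul1r.
Qed.

Lemma ideal_gen_mull A f g : ideal_gen A f -> ideal_gen A (g * f).
Proof.
move=> [m [c [h [Ah ->]]]]; exists m, (fun l => g * c l), h; split=> //.
by rewrite mulr_sumr; apply: eq_bigr => l _; rewrite mulrA.
Qed.

Lemma ideal_gen0 A : ideal_gen A 0.
Proof. by exists 0%N, (fun=> 0), (fun=> 0); split=> [[]//|]; rewrite big_ord0. Qed.

Lemma ideal_genD A f g : ideal_gen A f -> ideal_gen A g -> ideal_gen A (f + g).
Proof.
move=> [m [c [h [Ah ->]]]] [m' [c' [h' [Ah' ->]]]].
exists (m + m')%N,
  (fun l => match split l with inl i => c i | inr j => c' j end),
  (fun l => match split l with inl i => h i | inr j => h' j end).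
split=> [l|]; first by case: (split l).
rewrite big_split_ord /=; congr (_ + _); apply: eq_bigr => l _.
  by rewrite -[lshift _ _]/(unsplit (inl _ l)) unsplitK.
by rewrite -[rshift _ _]/(unsplit (inr _ l)) unsplitK.
Qed.

End Ideals.

Section Graph.
Variables (k : fieldType) (n : nat).
Implicit Types (e : rel 'I_n) (i j u v : 'I_n) (t : nat) (b : 'X_{1..n}).
Implicit Types (I P : {mpoly k[n]} -> Prop).

(* Graphs are given by their adjacency relation. *)
Definition simple_graph e : Prop := ssrbool.symmetric e /\ irreflexive e.
Definition no_isolated e : Prop := forall u, exists v, e u v.

Definition edge_prime i j : {mpoly k[n]} -> Prop :=
  ideal_gen (fun f => f = 'X_i \/ f = 'X_j).

Definition cover_ideal_sympow e t : {mpoly k[n]} -> Prop := fun f =>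
  forall u v, e u v -> ideal_exp (edge_prime u v) t f.

Definition local_v I P : nat :=
  nat_min (fun d => exists f : {mpoly k[n]},
    f \is d.-homog /\ ideal_eq (ideal_colon I f) P).

Definition t_cover e t b : bool :=
  [forall u, forall v, e u v ==> (t <= b u + b v)%N].

Definition tight_t_cover e t i j b : bool :=
  t_cover e t b && (b i + b j == t)%N.

Definition gamma e t i j : nat :=
  nat_min (fun d => exists b, tight_t_cover e t i j b /\ mdeg b = d).

(* For an edge {i, j} and t >= 1, (x_i, x_j) is associated to the t-th symbolic
   power, and the minima defining gamma and local_v are over nonempty sets. *)
Lemma gamma_nonempty e t i j : simple_graph e -> e i j ->
  exists d b, tight_t_cover e t i j b /\ mdeg b = d.
Proof.
move=> [_ irr] eij; pose b := [multinom (if l == j then 0 else t)%N | l < n].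
exists (mdeg b), b; split=> //; apply/andP; split.
  apply/forallP=> u; apply/forallP=> v; apply/implyP=> euv; rewrite !mnmE.
  case: eqP => [ju|_]; last exact: leq_addr.
  case: eqP => [jv|_]; last exact: leq_addl.
  by rewrite ju jv irr in euv.
rewrite !mnmE eqxx addn0; case: (i =P j) => [ij|_]; last exact: eqxx.
by rewrite ij irr in eij.
Qed.

Lemma ideal_exp_mull I t (f g : {mpoly k[n]}) :
  ideal_exp I t f -> ideal_exp I t (g * f).
Proof. by case: t => [|t] //; apply: ideal_gen_mull. Qed.

Lemma ideal_expX I t (f : {mpoly k[n]}) : I f -> ideal_exp I t (f ^+ t).
Proof.
move=> If; elim: t => //= t IH; apply: ideal_gen_inc.
by exists f, (f ^+ t); rewrite exprS.
Qed.

Lemma edge_prime_exp_msupp i j t (f : {mpoly k[n]}) : i != j ->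
  ideal_exp (edge_prime i j) t f ->
  forall b, b \in msupp f -> (t <= b i + b j)%N.
Proof.
move=> ij; elim: t f => // t IH f /= [m [c [g [Hg ->]]]] b /msupp_sum_le.
case/flatten_mapP=> l _ /msuppM_le /allpairsP [[b1 b2] /= [_ Hb2 ->]].
have [p [q [Hp Hq Egl]]] := Hg l; move: Hb2; rewrite Egl.
move=> /msuppM_le /allpairsP [[b3 b4] /= [Hb3 /(IH _ Hq) Hb4 ->]].
suff H3 : (1 <= b3 i + b3 j)%N.
  by rewrite !mnmDE addnACA (leq_trans _ (leq_addl _ _)) // addnACA (leq_add H3).
case: Hp Hb3 => m' [c' [g' [Hg' ->]]] /msupp_sum_le.
case/flatten_mapP=> l' _ /msuppM_le /allpairsP [[b5 b6] /= [_ Hb6 ->]].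
case: (Hg' l') Hb6 => ->; rewrite msuppX inE => /eqP ->;
  by rewrite !mnmDE !mnmE eqxx ?addn1 ?addnS ?addSn.
Qed.

Lemma edge_prime_msupp i j (f : {mpoly k[n]}) :
  (forall b, b \in msupp f -> (1 <= b i + b j)%N) -> edge_prime i j f.
Proof.
move=> H; rewrite (mpolyE f) big_seq.
apply: (big_ind (edge_prime i j)); [exact: ideal_gen0|exact: ideal_genD|].
move=> b /H Hb; rewrite -mul_mpolyC; apply: ideal_gen_mull.
have X l : (0 < b l)%N -> 'X_[b] = 'X_[b - U_(l)] * 'X_l :> {mpoly k[n]}.
  by move=> bl; rewrite -mpolyXD submK // lep1mP -lt0n.
case: (posnP (b i)) Hb => [->|bi] bj; [rewrite (X j) //|rewrite (X i) //];
  by apply: ideal_gen_mull; apply: ideal_gen_inc; auto.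
Qed.

Lemma local_v_nonempty e t i j : simple_graph e -> e i j -> (0 < t)%N ->
  exists d (f : {mpoly k[n]}), f \is d.-homog /\
    ideal_eq (ideal_colon (cover_ideal_sympow e t) f) (edge_prime i j).
Proof.
case: t => // t [sym irr] eij _.
have ij : i != j by apply/eqP=> ij; rewrite ij irr in eij.
pose b := [multinom (if l == j then 0 else if l == i then t else t.+1)%N | l < n].
have bi : b i = t by rewrite mnmE eqxx (negbTE ij).
have bj : b j = 0%N by rewrite mnmE eqxx.
have X l s : (s <= b l)%N ->
    'X_[b] = 'X_[b - U_(l) *+ s] * 'X_l ^+ s :> {mpoly k[n]}.
  move=> bl; rewrite mpolyXn -mpolyXD submK //; apply/mnm_lepP=> l'.
  by rewrite mulmnE mnmE; case: eqP => [<-|_]; rewrite ?mul1n ?mul0n.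
exists (mdeg b), 'X_[b]; split; first by rewrite dhomogX.
move=> g; split=> [Hg|Hg u v euv]; rewrite /ideal_colon.
  apply: edge_prime_msupp => m Hm.
  have /(edge_prime_exp_msupp ij) := Hg _ _ eij.
  move=> /(_ (m + b)%MM); rewrite mcoeff_msupp addmC mcoeffMX -mcoeff_msupp.
  by move=> /(_ Hm); rewrite !mnmDE bi bj addnACA addn0 -addn1 leq_add2l.
have big l : l != i -> l != j -> (t < b l)%N.
  by move=> li lj; rewrite mnmE (negbTE li) (negbTE lj).
have mem l : edge_prime u v 'X_l -> (t < b l)%N ->
    ideal_exp (edge_prime u v) t.+1 (g * 'X_[b]).
  move=> Hl /X ->; rewrite mulrA; apply: ideal_exp_mull; exact: ideal_expX.
have Xu : edge_prime u v 'X_u by apply: ideal_gen_inc; left.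
have Xv : edge_prime u v 'X_v by apply: ideal_gen_inc; right.
have [/(mem _ Xu)//|bu] := ltnP t (b u).
have [/(mem _ Xv)//|bv] := ltnP t (b v).
have Huv : ideal_eq (edge_prime u v) (edge_prime i j) /\
    edge_prime u v 'X_i.
  have uij : (u == i) || (u == j).
    by apply: contraLR bu => /norP[? ?]; rewrite -ltnNge big.
  have vij : (v == i) || (v == j).
    by apply: contraLR bv => /norP[? ?]; rewrite -ltnNge big.
  case/orP: uij => /eqP Eu; case/orP: vij => /eqP Ev; move: euv;
    rewrite ?Eu ?Ev ?irr // => _; subst u v; split=> //.
  by move=> f; split=> -[m [c [h [Hh ->]]]]; exists m, c, h; split=> // l;
    case: (Hh l); auto.
case: Huv => Huv Xi; rewrite (X i t) ?bi // mulrCA; apply: ideal_exp_mull.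
apply: ideal_gen_inc; exists g, ('X_i ^+ t); split=> //; first exact/Huv.
exact: ideal_expX.
Qed.

End Graph.

Arguments edge_prime k {n} i j f.
Arguments cover_ideal_sympow k {n} e t f.

(* Main.v *)
Require Import Defs.
From mathcomp Require Import all_boot all_algebra.
From mathcomp Require Import zify.

(** A homogeneous [f] with [J^(t) : f = P] has a monomial [x^a] in its support
with the same property, and [J^(t) : x^a = P] says that [a] satisfies the
[t]-cover inequality at every edge except [P], where [a_i + a_j = t - 1].
Adding a [P]-tight 2-cover to such an [a] raises [t] by 2. Conversely, for
[t >= 4] such an [a] is the sum of a [P]-tight 2-cover [b] and a vector of the
same kind for [t - 2]: with [s = 0] if [a_i], [a_j] are both positive and
[s = 1] otherwise, take [b_u = 0], [1] or [2] according to whether [a_u <= s],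
[s < a_u < t - s] or [t - s <= a_u]. *)

Set Implicit Arguments.
Unset Strict Implicit.
Unset Printing Implicit Defensive.

Import GRing.Theory.

Section NearCovers.
Variables (n : nat) (e : rel 'I_n) (i j : 'I_n).
Implicit Types (a b : 'X_{1..n}) (t d : nat) (u v : 'I_n).

Lemma t_coverP t b :
  reflect (forall u v, e u v -> t <= b u + b v) (t_cover e t b).
Proof.
apply: (iffP forallP) => [H u v euv|H u].
  by have /forallP/(_ v)/implyP := H u; apply.
by apply/forallP=> v; apply/implyP; apply: H.
Qed.

(** The successor form avoids truncated subtraction and forces [0 < t]. *)
Definition near_cover t a : Prop :=
  (a i + a j).+1 = t /\
  forall u v, e u v -> (u, v) \notin [:: (i, j); (j, i)] -> t <= a u + a v.

Lemma near_cover_addl t a : near_cover t a -> t_cover e t (a + U_(i))%MM.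
Proof.
move=> [aij aP]; apply/t_coverP=> u v euv; rewrite !mnmDE !mnm1E.
have [|/(aP _ _ euv)] := boolP ((u, v) \in [:: (i, j); (j, i)]); last by lia.
by rewrite !inE !xpair_eqE => /orP[]/andP[/eqP-> /eqP->]; rewrite eqxx; lia.
Qed.

Lemma near_cover_addr t a : near_cover t a -> t_cover e t (a + U_(j))%MM.
Proof.
move=> [aij aP]; apply/t_coverP=> u v euv; rewrite !mnmDE !mnm1E.
have [|/(aP _ _ euv)] := boolP ((u, v) \in [:: (i, j); (j, i)]); last by lia.
by rewrite !inE !xpair_eqE => /orP[]/andP[/eqP-> /eqP->]; rewrite eqxx; lia.
Qed.

Lemma near_coverD s t b a : tight_t_cover e s i j b -> near_cover t a ->
  near_cover (t + s) (b + a)%MM.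
Proof.
move=> /andP[/t_coverP bP /eqP bij] [aij aP]; split; first by rewrite !mnmDE; lia.
by move=> u v euv uv; rewrite !mnmDE; move: (bP _ _ euv) (aP _ _ euv uv); lia.
Qed.

Lemma near_cover_split t a : 2 <= t -> near_cover (t + 2) a ->
  exists b c, [/\ tight_t_cover e 2 i j b, near_cover t c & a = (b + c)%MM].
Proof.
(* If one of [a i], [a j] is 0, the other is [t + 1], and the shift [s = 1] lets it receive the
   value 2. Either way [b i + b j = 2]. *)
move=> t2 [aij aP]; pose s : nat := (a i == 0) || (a j == 0).
pose b := [multinom (s < a u) + (t + 2 <= a u + s) | u < n].
have s_le1 : s <= 1 by rewrite /s; case: orb.
have sP : s = ((a i == 0) || (a j == 0)) by [].
exists b, (a - b)%MM; split.
- apply/andP; split; last by rewrite !mnmE; lia.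
  (* On an edge other than [P], a value at most [s] at one end forces at least [t + 2 - s] at the
     other, where [b] is 2. *)
  apply/t_coverP=> u v euv; rewrite !mnmE.
  have [|/(aP _ _ euv)] := boolP ((u, v) \in [:: (i, j); (j, i)]); last by lia.
  by rewrite !inE !xpair_eqE => /orP[]/andP[/eqP-> /eqP->]; lia.
- split; first by rewrite !mnmBE !mnmE; lia.
  (* If [b u + b v] is 3, then [a u + a v >= t + 3]; if it is 4, then
     [a u + a v >= 2 * (t + 2 - s)], which is at least [t + 4] because [t >= 2]. *)
  by move=> u v euv /(aP _ _ euv); rewrite !mnmBE !mnmE; lia.
- by rewrite addmC submK //; apply/mnm_lepP=> u; rewrite mnmE; lia.
Qed.

Hypotheses (Gsimple : simple_graph e) (eij : e i j).

Lemma edge_neq u v : e u v -> u != v.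
Proof. by case: Gsimple => _ irr; apply: contraTneq => ->; rewrite irr. Qed.

(** An edge other than [P] misses [i] or [j], so one of the two increments leaves its sum unchanged.
    Hence only [P] can violate the inequality, and by exactly 1. *)
Lemma near_coverI t a : ~~ t_cover e t a ->
  t_cover e t (a + U_(i))%MM -> t_cover e t (a + U_(j))%MM -> near_cover t a.
Proof.
move=> aN /t_coverP ai /t_coverP aj; have ij := edge_neq eij.
have far u v : e u v -> (u, v) \notin [:: (i, j); (j, i)] -> t <= a u + a v.
  move=> euv; move: (ai _ _ euv) (aj _ _ euv) (edge_neq euv).
  rewrite !mnmDE !mnm1E !inE !xpair_eqE.
  rewrite ![i == _]eq_sym ![j == _]eq_sym.
  case: (u =P i) => [->|_]; first by rewrite (negbTE ij) eq_sym; case: eqP; lia.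
  case: (v =P i) => [->|_]; last by lia.
  by rewrite (negbTE ij); case: eqP; lia.
split=> //; have := ai _ _ eij.
rewrite !mnmDE !mnm1E eqxx (negbTE ij) => aij.
apply/eqP; rewrite eqn_leq; apply/andP; split; last by lia.
rewrite ltnNge; apply: contra aN => le; apply/t_coverP=> u v euv.
have [|/(far _ _ euv)//] := boolP ((u, v) \in [:: (i, j); (j, i)]).
by rewrite !inE !xpair_eqE => /orP[]/andP[/eqP-> /eqP->]; rewrite // addnC.
Qed.

Section Ideals.
Variable k : fieldType.
Implicit Types f g : {mpoly k[n]}.
Local Open Scope ring_scope.

Lemma edge_prime_expP u v t f : u != v ->
  ideal_exp (edge_prime k u v) t f <->
  (forall b, b \in msupp f -> (t <= b u + b v)%N).
Proof.
move=> uv; split; first exact: edge_prime_exp_msupp.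
have mono b : (t <= b u + b v)%N ->
    ideal_exp (edge_prime k u v) t 'X_[b].
  elim: t b => [//|t IH] b tb.
  have step l : l = u \/ l = v -> (0 < b l)%N ->
      ideal_exp (edge_prime k u v) t.+1 'X_[b].
    move=> luv bl; apply: ideal_gen_inc; exists 'X_l, 'X_[b - U_(l)]; split.
    - by apply: ideal_gen_inc; case: luv => ->; [left|right].
    - apply: IH; rewrite !mnmBE !mnm1E.
      by case: luv bl => ->; rewrite eqxx ?[v == u]eq_sym (negbTE uv); lia.
    - by rewrite -mpolyXD addmC submK // lep1mP -lt0n.
  by case: (posnP (b u)) => [bu|/step]; [apply: (step v)|]; auto; lia.
(* The power 0 is the whole ring by definition; only positive powers have the form [ideal_gen]. *)
case: t mono => [//|t] mono fP; rewrite (mpolyE f) big_seq.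
apply: (big_ind (ideal_exp (edge_prime k u v) t.+1));
  [exact: ideal_gen0|exact: ideal_genD|].
by move=> b /fP /mono bP; rewrite -mul_mpolyC; apply: ideal_gen_mull.
Qed.

Lemma cover_ideal_sympowP t f :
  cover_ideal_sympow k e t f <-> (forall b, b \in msupp f -> t_cover e t b).
Proof.
split=> [fJ b bf|fJ u v euv].
  apply/t_coverP=> u v euv.
  by have /(edge_prime_expP _ _ (edge_neq euv))/(_ b bf) := fJ u v euv.
apply/(edge_prime_expP _ _ (edge_neq euv)) => b /fJ /t_coverP; exact.
Qed.

Lemma edge_primeP f : edge_prime k i j f <->
  (forall b, b \in msupp f -> (1 <= b i + b j)%N).
Proof.
split=> [fP|]; last exact: edge_prime_msupp.
apply/(edge_prime_expP 1 f (edge_neq eij))/ideal_gen_inc.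
by exists f, 1; rewrite mulr1.
Qed.

Lemma msupp_mulX f a b : (b \in msupp f) = ((a + b)%MM \in msupp (f * 'X_[a])).
Proof. by rewrite !mcoeff_msupp mcoeffMX. Qed.

(** At [P] the vector [a] lacks exactly 1, so a cover [a + b] needs [b i + b j >= 1]. Conversely,
    such a [b] dominates [U_(i)] or [U_(j)], and either of these already repairs [a]. *)
Lemma colon_near_cover t a : near_cover t a ->
  ideal_eq (ideal_colon (cover_ideal_sympow k e t) 'X_[a]) (edge_prime k i j).
Proof.
move=> aP g; rewrite edge_primeP; split=> [/cover_ideal_sympowP gJ b|gP].
  rewrite (msupp_mulX g a) => /gJ /t_coverP /(_ _ _ eij).
  by case: aP => aij _; rewrite !mnmDE; lia.
apply/cover_ideal_sympowP => m; rewrite (perm_mem (msuppMX g a)) => /mapP[b /gP bij ->].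
have step l : (0 < b l)%N -> t_cover e t (a + U_(l)) -> t_cover e t (a + b).
  move=> bl /t_coverP cov; apply/t_coverP=> u v /cov; rewrite !mnmDE !mnm1E.
  by case: eqP => [<-|_]; case: eqP => [<-|_]; lia.
case: (posnP (b i)) => [bi|/step]; last by apply; apply: near_cover_addl.
by apply: (step j); [lia|apply: near_cover_addr].
Qed.

Lemma colon_msupp_near_cover t f :
  ideal_eq (ideal_colon (cover_ideal_sympow k e t) f) (edge_prime k i j) ->
  exists2 a, a \in msupp f & near_cover t a.
Proof.
move=> fP; have cov l : edge_prime k i j 'X_l ->
    {in msupp f, forall a, t_cover e t (a + U_(l))%MM}.
  move=> /fP /cover_ideal_sympowP lJ a; rewrite (msupp_mulX f U_(l)) addmC mulrC.
  exact: lJ.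
(* Were all exponents of [f] covers, [f] would lie in the symbolic power and the colon would contain
   1, which is not in [P]. *)
have [/allP fJ|/allPn[a af aN]] := boolP (all (t_cover e t) (msupp f)).
  have /edge_primeP/(_ 0%MM) : edge_prime k i j 1.
    by apply/fP; rewrite /ideal_colon mul1r; apply/cover_ideal_sympowP.
  by rewrite msupp1 inE eqxx !mnm0E => /(_ isT).
exists a => //; apply: near_coverI => //; apply: cov => //;
  by apply: ideal_gen_inc; auto.
Qed.

Lemma local_v_le t a : near_cover t a ->
  (local_v (cover_ideal_sympow k e t) (edge_prime k i j) <= mdeg a)%N.
Proof.
move=> aP; have t0 : (0 < t)%N by case: aP => <-.
have [_] := nat_minP (local_v_nonempty k Gsimple eij t0); apply.
by exists 'X_[a]; split; [rewrite dhomogX|apply: colon_near_cover].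
Qed.

Lemma local_v_attained t : (0 < t)%N -> exists2 a, near_cover t a &
  mdeg a = local_v (cover_ideal_sympow k e t) (edge_prime k i j).
Proof.
move=> t0; have [[f [fh /colon_msupp_near_cover[a af aP]]] _] :=
  nat_minP (local_v_nonempty k Gsimple eij t0).
(* By homogeneity every monomial of [f] has the degree of [f]. *)
by exists a => //; have /dhomogP/(_ _ af) := fh.
Qed.

End Ideals.
End NearCovers.

Theorem theorem1p4 (k : fieldType) (n : nat) (e : rel 'I_n)
    (Gsimple : simple_graph e) (Gnoiso : no_isolated e)
    (i j : 'I_n) (eij : e i j) (t : nat) (ht : (2 <= t)%N) :
  local_v (cover_ideal_sympow k e (t + 2)) (edge_prime k i j) =
  (local_v (cover_ideal_sympow k e t) (edge_prime k i j) +
    gamma e 2 i j)%N.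
Proof.
have [[b [bP bE]] gamma_le] := nat_minP (gamma_nonempty 2 Gsimple eij).
apply/eqP; rewrite eqn_leq; apply/andP; split.
  (* Upper bound: add a minimal tight 2-cover to a minimizer for [t]. *)
  have [a aP <-] := local_v_attained Gsimple eij k (ltnW ht).
  rewrite /gamma -bE [leqRHS]addnC -mdegD.
  exact/(local_v_le Gsimple eij)/near_coverD/aP/bP.
(* Lower bound: split a minimizer for [t + 2]; each summand has at least the corresponding minimal
   degree. *)
have [a aP <-] := local_v_attained Gsimple eij k (ltn_addr 2 (ltnW ht)).
have [c [d [cP dP ->]]] := near_cover_split ht aP.
rewrite mdegD addnC leq_add ?(local_v_le Gsimple eij) //.
by apply: gamma_le; exists c.
Qed.
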